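(* Consider the two-player volunteer's dilemma with benefit $B\in(1,2)$ and uniformly distributed private costs $x\in\mathcal X=[0,1]$ described in the context. Let $\tilde X$ be the set of indifferent types of QRE, i.e. the set of all $\tilde x(\sigma)$ with $\sigma\in\Sigma$ a QRE, where $\tilde x(\sigma)$ is the type with $\Delta\bar u_{\tilde x(\sigma)}(\sigma)=0$. Then $\tilde X=\left(\frac{B}{B+2},\frac{2B}{B+2}\right)$, and a strategy $\sigma\in\Sigma$ is a QRE if and only if: (i) $\sigma$ is continuous and strictly increasing; (ii) $\sigma(x)\in(0,1)$ for all $x\in\mathcal X$; (iii) there exists a unique indifferent type $\tilde x\in\tilde X=\left(\frac{B}{B+2},\frac{2B}{B+2}\right)$ such that $\sigma(\tilde x)=\frac12$ and $\tilde x=B\int_0^1\sigma(x')\,dx'$.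
   Context: Volunteer's dilemma. Two players simultaneously choose to volunteer (action 0) or abstain (action 1). If at least one volunteers, both receive $B$; a volunteer pays their private cost $x$, with $x$ uniform on $[0,1]$, i.i.d. across players. $\Sigma$ is the set of Lebesgue measurable $\sigma:[0,1]\to[0,1]$, where $\sigma(x)$ is the probability that a player with cost $x$ abstains; both players use the same $\sigma$. The expected payoffs of type $x$ are $\bar u^0_x(\sigma)=B-x$ (volunteer) and $\bar u^1_x(\sigma)=B\int_0^1(1-\sigma(x'))\,dx'$ (abstain); write $\bar u_x(\sigma)=(\bar u^1_x(\sigma),\bar u^0_x(\sigma))$ and $\Delta\bar u_x(\sigma)=\bar u^1_x(\sigma)-\bar u^0_x(\sigma)=x-B\int_0^1\sigma(x')\,dx'$. QRE. $\sigma\in\Sigma$ is a QRE if there exists $Q:\mathbb R^2\to[0,1]$ with $\sigma(x)=Q(\bar u_x(\sigma))$ for all $x\in[0,1]$ satisfying, with $v=(v^1,v^0)$: (R1) $Q(v)\in(0,1)$ for all $v$; (R2) $Q$ is continuous; (R3) $\frac{\partial Q(v)}{\partial v^1}>0>\frac{\partial Q(v)}{\partial v^0}$ for all $v\in\mathbb R^2$; (R4) $v^1>v^0\iff Q(v)>1-Q(v)$.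
   Formalization: The ''if'' direction fails for kinked σ, since (R3) forces differentiability; so (i) also requires σ to have a positive derivative on [0,1] (one-sided at 0 and 1). The literal (i)–(iii) equivalence is proved with (R3) read as strict monotonicity of Q in each coordinate. *)

(* Defs.v *)
From HB Require Import structures.
From mathcomp Require Import all_boot all_order all_algebra.
From mathcomp Require Import all_classical all_reals all_analysis.
Set Implicit Arguments.
Unset Strict Implicit.
Unset Printing Implicit Defensive.
Import Order.TTheory GRing.Theory Num.Theory.
Import numFieldNormedType.Exports.
Local Open Scope classical_set_scope.
Local Open Scope ring_scope.

(* [R] with the sigma-algebra of Lebesgue (not just Borel) measurable sets. *)
Notation lebesgue_type R := (caratheodory_type (wlength (@idfun R))^*%mu).

Section VolunteersDilemma.
Variable R : realType.
Implicit Types (B x : R) (sigma : R -> R) (Q : R * R -> R) (v : R * R).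

(* A strategy is carried by a total function, of which only the restriction to
   [0, 1] matters; [sigma x] is the probability that type [x] abstains. *)
Definition is_strategy sigma : Prop :=
  {in `[0, 1], forall x, 0 <= sigma x <= 1} /\
  measurable_fun (T := lebesgue_type R) `[0, 1]%classic sigma.

Definition payoff_volunteer B x : R := B - x.

Definition payoff_abstain B sigma : R :=
  B * \int[@completed_lebesgue_measure R]_(x' in `[0, 1]) (1 - sigma x').

(* Payoff vectors are ordered as (v^1, v^0): abstaining comes first. *)
Definition payoffs B sigma x : R * R :=
  (payoff_abstain B sigma, payoff_volunteer B x).

Definition payoff_gain B sigma x : R :=
  (payoffs B sigma x).1 - (payoffs B sigma x).2.

Definition interior_response Q : Prop := forall v, 0 < Q v < 1.

Definition differentially_responsive Q : Prop := forall v,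
  [/\ derivable (fun a => Q (a, v.2)) v.1 1,
      derivable (fun b => Q (v.1, b)) v.2 1,
      0 < derive1 (fun a => Q (a, v.2)) v.1 &
      derive1 (fun b => Q (v.1, b)) v.2 < 0].

(* Derivative-free form of responsiveness: strict monotonicity in each
   coordinate. It is implied by [differentially_responsive]. *)
Definition strictly_responsive Q : Prop :=
  (forall b, {homo (fun a => Q (a, b)) : a a' / a < a'}) /\
  (forall a, {homo (fun b => Q (a, b)) : b b' /~ b < b'}).

Definition payoff_monotone Q : Prop := forall v, v.2 < v.1 <-> 1 - Q v < Q v.

(* Regular quantal response equilibrium, for a given form of the responsiveness
   axiom. That [Q] takes values in [0, 1] is part of [interior_response]. *)
Definition is_QRE_with (responsive : (R * R -> R) -> Prop) B sigma : Prop :=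
  is_strategy sigma /\
  exists Q, [/\ {in `[0, 1], forall x, sigma x = Q (payoffs B sigma x)},
                interior_response Q, continuous Q, responsive Q &
                payoff_monotone Q].

Definition is_QRE := is_QRE_with differentially_responsive.

Definition is_monotone_QRE := is_QRE_with strictly_responsive.

Definition indifferent_type B sigma x : Prop :=
  x \in `[0, 1] /\ payoff_gain B sigma x = 0.

Definition indifferent_types (P : (R -> R) -> Prop) B : set R :=
  [set x | exists2 sigma, P sigma & indifferent_type B sigma x].

Definition continuous_increasing sigma : Prop :=
  {within `[0, 1], continuous sigma} /\
  {in `[0, 1] &, {homo sigma : x y / x < y}}.

(* Differentiable on [0, 1], one-sidedly at 0 and 1, with positive derivative.
   With partial derivatives in the responsiveness axiom every equilibrium has
   this property, since then sigma'(x) = - dQ/dv^0 (payoffs x); continuity and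
   strict monotonicity alone do not imply it (kinks, inflection points). *)
Definition positive_slope sigma : Prop := {in `[0, 1], forall x,
  exists2 l : R, 0 < l &
    (sigma y - sigma x) / (y - x) @[y --> within `[0, 1] x^'] --> l}.

Definition interior_strategy sigma : Prop :=
  {in `[0, 1], forall x, 0 < sigma x < 1}.

Definition unique_indifferent_type B sigma : Prop :=
  exists! t, [/\ t \in `]B / (B + 2), 2 * B / (B + 2)[, sigma t = 1 / 2 &
    t = B * \int[@completed_lebesgue_measure R]_(x' in `[0, 1]) sigma x'].

End VolunteersDilemma.

(* Main.v *)
Require Import Defs.
From HB Require Import structures.
From mathcomp Require Import all_boot all_order all_algebra.
From mathcomp Require Import all_classical all_reals all_analysis.
From mathcomp Require Import measurable_realfun.
From mathcomp Require Import lra ring.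
Import Order.TTheory GRing.Theory Num.Theory.
Import numFieldNormedType.Exports.
Local Open Scope classical_set_scope.
Local Open Scope ring_scope.

Set Implicit Arguments.
Unset Strict Implicit.
Unset Printing Implicit Defensive.

(** Write m for the mean of sigma and t = B m, so that type x gains x - t from
abstaining. Necessity: at equal payoffs continuity forces Q = 1/2, so sigma
crosses 1/2 exactly at t; bounding sigma by step functions with a jump at t
gives (1 - t) / 2 < m < 1 - t / 2, which is the stated interval for t = B m.
Sufficiency: extend sigma beyond [0, 1] by arcs of hyperbolas that match the
one-sided slopes at 0 and 1, and let Q v be the extension at v^1 - v^0 + t.
Every t in the interval occurs: the strategies that cross 1/2 at t with a
positive slope form a convex set on which the mean is affine, and their means
come arbitrarily close to both (1 - t) / 2 and 1 - t / 2. *)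

(** * Derivatives relative to a set, and gluing of functions at a point *)

Section slopes.
Variable R : realType.
Implicit Types (D : set R) (f g : R -> R) (c x l : R).

(** The limit of [positive_slope] over a general domain: the derivative when [D] is [setT], a
    one-sided derivative at an end of an interval [D]. *)
Definition slope_within D f x l : Prop :=
  (f y - f x) / (y - x) @[y --> within D x^'] --> l.

(** Substitute y = x + h: both shifts are continuous and injective, so they respect punctured
    neighbourhoods. *)
Lemma is_derive_slope f x l :
  is_derive x 1 f l <-> slope_within setT f x l.
Proof.
have sE : slope_within setT f x l <->
    h^-1 *: ((f \o shift x) (h *: 1) - f x) @[h --> 0^'] --> l.
  split.
  - have sh : (h + x : R) @[h --> (0 : R)^'] --> x^'.
      rewrite -{2}(add0r x).
      apply: (@continuous_injective_withinNx R R (fun h : R => h + x)).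
        by apply: continuousD; [exact: cvg_id|exact: cvg_cst].
      by move=> y /addIr.
    move=> H; have {}H : (f y - f x) / (y - x) @[y --> x^'] --> l.
      apply: cvg_trans H => A; rewrite /fmap/within/nbhs/= => HA.
      by apply: filterS HA => y /(_ I).
    have := cvg_comp _ _ sh H; apply: cvg_trans; apply: near_eq_cvg.
    by near=> h => /=; rewrite addrK mulrC [h *: 1]mulr1.
  - have sh : (y - x : R) @[y --> x^'] --> (0 : R)^'.
      rewrite -(subrr x).
      apply: (@continuous_injective_withinNx R R (fun y : R => y - x)).
        by apply: continuousB; [exact: cvg_id|exact: cvg_cst].
      by move=> y /addIr.
    move=> H; apply: cvg_within_filter.
    have := cvg_comp _ _ sh H; apply: cvg_trans; apply: near_eq_cvg.
    by near=> y => /=; rewrite mulrC [(y - x) *: 1]mulr1 subrK.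
rewrite sE; split=> [[df <-]|df]; first exact: df.
by apply: DeriveDef; [apply/cvg_ex; exists l|apply: cvg_lim].
Unshelve. all: by end_near. Qed.

Lemma slope_withinS D D' f x l : D' `<=` D ->
  slope_within D f x l -> slope_within D' f x l.
Proof.
move=> DD; apply: cvg_trans => A; rewrite /fmap/within/nbhs/=.
by apply: filterS => y + /DD.
Qed.

Lemma slope_withinU D D' f x l : slope_within D f x l ->
  slope_within D' f x l -> slope_within (D `|` D') f x l.
Proof.
move=> H H' A Al; have := H _ Al; have := H' _ Al.
rewrite /fmap /within /nbhs /=.
by apply: filterS2 => y a b [/b|/a].
Qed.

Lemma eq_slope_within D f g x l : f x = g x -> {in D, f =1 g} ->
  slope_within D f x l -> slope_within D g x l.
Proof.
move=> fgx fg; apply: cvg_trans; apply: near_eq_cvg.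
rewrite near_withinE; near=> y => Dy.
by rewrite fgx fg ?inE.
Unshelve. all: by end_near. Qed.

(** The filter contains the empty set and so converges to every [l]; [slope_glue] uses this to
    discard the piece that stays away from [x]. *)
Lemma slope_within_void D f x l :
  (\forall y \near x, ~ D y) -> slope_within D f x l.
Proof.
move=> H A Al; rewrite /fmap /within /nbhs /=.
by apply: nbhs_dnbhs; apply: filterS H.
Qed.

Definition glue c f g x : R := if x <= c then f x else g x.

Lemma glueL c f g x : x <= c -> glue c f g x = f x.
Proof. by rewrite /glue => ->. Qed.

Lemma glueR c f g x : f c = g c -> c <= x -> glue c f g x = g x.
Proof.
by rewrite /glue => fg cx; case: ifPn => // xc; rewrite (_ : x = c) //; lra.
Qed.

Let splitD D c : D = (D `&` [set y | y <= c]) `|` (D `&` [set y | c <= y]).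
Proof.
rewrite -setIUr; apply/esym/setIidPl => y _ /=.
by case: (leP y c) => [|/ltW]; [left|right].
Qed.

(** Both premises apply at [x = c], where the one-sided slopes have to agree; elsewhere one piece
    misses a neighbourhood of [x] and imposes nothing. *)
Lemma slope_glue D c f g x l : f c = g c ->
  (x <= c -> slope_within (D `&` [set y | y <= c]) f x l) ->
  (c <= x -> slope_within (D `&` [set y | c <= y]) g x l) ->
  slope_within D (glue c f g) x l.
Proof.
move=> fg Hf Hg.
rewrite (splitD D c).
apply: slope_withinU.
- have [xc|cx] := leP x c.
    apply: (eq_slope_within _ _ (Hf xc)); first by rewrite glueL.
    by move=> y; rewrite inE => -[_ /= yc]; rewrite glueL.
  apply: slope_within_void.
  by near=> y => -[_ /=]; apply/negP; rewrite -ltNge; near: y; exact: lt_nbhsr.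
- have [cx|xc] := leP c x.
    apply: (eq_slope_within _ _ (Hg cx)); first by rewrite glueR.
    by move=> y; rewrite inE => -[_ /= yc]; rewrite glueR.
  apply: slope_within_void.
  by near=> y => -[_ /=]; apply/negP; rewrite -ltNge; near: y; exact: lt_nbhsl.
Unshelve. all: by end_near. Qed.

(** When [c] separates [x] and [y], the comparison passes through the common value at [c]. *)
Lemma homo_glue D c f g : D c -> f c = g c ->
  (forall x y, D x -> D y -> x < y -> y <= c -> f x < f y) ->
  (forall x y, D x -> D y -> x < y -> c <= x -> g x < g y) ->
  forall x y, D x -> D y -> x < y -> glue c f g x < glue c f g y.
Proof.
move=> Dc fg Hf Hg x y Dx Dy xy.
have [yc|cy] := leP y c; first by rewrite !glueL//; [exact: Hf|lra].
rewrite [ltRHS]glueR ?(ltW cy)//.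
have [cx|xc] := leP c x; first by rewrite glueR//; exact: Hg.
rewrite glueL ?(ltW xc)//; apply: (@lt_trans _ _ (f c)); first exact: Hf.
by rewrite fg; exact: Hg.
Qed.

Lemma continuous_glue D c f g : closed D -> f c = g c ->
  {within D `&` [set y | y <= c], continuous f} ->
  {within D `&` [set y | c <= y], continuous g} ->
  {within D, continuous (glue c f g)}.
Proof.
move=> cD fg Hf Hg.
rewrite (splitD D c).
apply: withinU_continuous.
- by apply: closedI => //; exact: closed_le.
- by apply: closedI => //; exact: closed_ge.
- apply: subspace_eq_continuous Hf => y; rewrite inE => -[_ /= yc].
  by rewrite /from_subspace glueL.
- apply: subspace_eq_continuous Hg => y; rewrite inE => -[_ /= yc].
  by rewrite /from_subspace glueR.
Qed.

End slopes.

(** * Means of strategies under the completed Lebesgue measure *)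

Section integrals.
Variable R : realType.
Implicit Types (sigma : R -> R) (c p x : R).
Local Notation mu := (@completed_lebesgue_measure R).
Local Notation mean sigma := (\int[mu]_(x in `[0, 1]) sigma x).

Lemma borel_lebesgue_measurable (A : set R) :
  measurable A -> measurable (A : set (lebesgue_type R)).
Proof. exact: sub_caratheodory. Qed.

(** Completion leaves the measure of an interval unchanged, and the Borel statement proves this one
    by conversion. *)
Lemma completed_lebesgue_measure_itv (i : interval R) :
  (mu : {measure set (lebesgue_type R) -> \bar R}) [set` i] =
  (if (i.1 < i.2)%E then ((i.2 : \bar R) - i.1)%E else 0).
Proof. exact: lebesgue_measure_itv. Qed.

Lemma strategy_of_continuous sigma : continuous sigma ->
  {in `[0, 1], forall x, 0 <= sigma x <= 1} -> is_strategy sigma.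
Proof.
move=> cs s01; split=> // _ Y mY; apply: borel_lebesgue_measurable.
apply: measurableI => //; rewrite -[X in measurable X]setTI.
exact: (@continuous_measurable_fun R sigma cs).
Qed.

Lemma strategy_integrable sigma : is_strategy sigma ->
  mu.-integrable `[0, 1] (EFin \o sigma).
Proof.
move=> [s01 ms]; apply: measurable_bounded_integrable => //.
- exact: borel_lebesgue_measurable.
- by rewrite completed_lebesgue_measure_itv /= lte01 sube0 ltry.
- exists 1; split=> // M M1 x /= x01; have /andP[? ?] := s01 x x01.
  by rewrite ger0_norm//; lra.
Qed.

Lemma cst_strategy c : 0 <= c <= 1 -> is_strategy (fun=> c : R).
Proof. by move=> c01; apply: strategy_of_continuous => // x; exact: cvg_cst. Qed.

Lemma strategyC sigma : is_strategy sigma -> is_strategy (fun x => 1 - sigma x).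
Proof.
move=> [s01 ms]; split=> [x /s01|]; first lra.
exact: measurable_funB.
Qed.

Lemma mean_cst c : 0 <= c <= 1 -> mean (fun=> c) = c.
Proof.
move=> c01; rewrite Rintegral_cst.
  by rewrite completed_lebesgue_measure_itv /= lte01 sube0 mulr1.
exact: borel_lebesgue_measurable.
Qed.

Lemma meanC sigma : is_strategy sigma ->
  mean (fun x => 1 - sigma x) = 1 - mean sigma.
Proof.
move=> ss; rewrite RintegralB ?mean_cst//; first lra.
- exact: borel_lebesgue_measurable.
- by apply: strategy_integrable; apply: cst_strategy; lra.
- exact: strategy_integrable.
Qed.

Lemma mean_convex sigma sigma' c : is_strategy sigma -> is_strategy sigma' ->
  mean (fun x => c * sigma x + (1 - c) * sigma' x) =
  c * mean sigma + (1 - c) * mean sigma'.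
Proof.
move=> /strategy_integrable ss /strategy_integrable ss'.
have m01 : measurable (`[0, 1]%classic : set (lebesgue_type R)).
  exact: borel_lebesgue_measurable.
rewrite RintegralD//; first by rewrite !RintegralZl.
- exact: (integrableZl m01 c ss).
- exact: (integrableZl m01 (1 - c) ss').
Qed.

(** The integral is split at [p] and the integrand compared with a constant on each piece. *)
Lemma mean_le_step sigma p c c' : is_strategy sigma -> 0 <= p <= 1 ->
  {in `[0, p[, forall x, sigma x <= c} ->
  {in `[p, 1], forall x, sigma x <= c'} ->
  mean sigma <= c * p + c' * (1 - p).
Proof.
move=> ss /andP[p0 p1] sc sc'.
have mI (i : interval R) : measurable ([set` i] : set (lebesgue_type R)).
  exact: borel_lebesgue_measurable.
have split01 : `[0, 1]%classic = `[0, p[%classic `|` `[p, 1]%classic :> set R.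
  by rewrite -itv_bndbnd_setU // bnd_simp.
have is01 := strategy_integrable ss.
have le_cst (i : interval R) k : [set` i] `<=` `[0, 1]%classic ->
    {in i, forall x, sigma x <= k} ->
    \int[mu]_(x in [set` i]) sigma x <= k * fine (mu [set` i]).
  move=> i01 sk; rewrite -Rintegral_cst//; apply: le_Rintegral => //.
  - exact: integrableS is01.
  - apply: measurable_bounded_integrable => //.
    + apply: (@le_lt_trans _ _ (mu `[0, 1]%classic)).
        by apply: le_measure => //; rewrite inE; exact: mI.
      by rewrite completed_lebesgue_measure_itv /= lte01 sube0 ltry.
    + by exists `|k|; split; [exact: normr_real|move=> M /ltW M1 x _].
rewrite split01 Rintegral_setU//; last 2 first.
- by rewrite -split01.
- apply/disj_setPLR => x /=; rewrite !in_itv /= => /andP[_ xp] /andP[]; lra.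
apply: lerD.
- apply: (le_trans (le_cst `[0, p[ c _ sc)).
    by move=> x /=; rewrite !in_itv /=; lra.
  rewrite completed_lebesgue_measure_itv /= lte_fin sube0.
  (* The measure formula returns 0 unless 0 < p; in the remaining case p = 0, so [c * p] vanishes
     too. *)
  by case: ltP => [//|?]; rewrite (_ : p = 0) //; lra.
- apply: (le_trans (le_cst `[p, 1] c' _ sc')).
    by move=> x /=; rewrite !in_itv /=; lra.
  rewrite completed_lebesgue_measure_itv /= lte_fin.
  by case: ltP => [//|?]; rewrite (_ : p = 1) ?subrr//; lra.
Qed.

(** The upper bound applied to [1 - sigma]. *)
Lemma mean_ge_step sigma p c c' : is_strategy sigma -> 0 <= p <= 1 ->
  {in `[0, p[, forall x, c <= sigma x} ->
  {in `[p, 1], forall x, c' <= sigma x} ->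
  c * p + c' * (1 - p) <= mean sigma.
Proof.
move=> ss p01 sc sc'.
have := @mean_le_step _ p (1 - c) (1 - c') (strategyC ss) p01.
rewrite meanC//.
move=> H; suff : 1 - mean sigma <= (1 - c) * p + (1 - c') * (1 - p) by lra.
by apply: H => x /[dup] xp; [move/sc|move/sc']; lra.
Qed.

Lemma payoff_gainE B sigma x : is_strategy sigma ->
  payoff_gain B sigma x = x - B * mean sigma.
Proof.
move=> ss; rewrite /payoff_gain /= /payoff_abstain /payoff_volunteer meanC//.
by ring.
Qed.

End integrals.

(** * Hyperbolic arcs with prescribed value and slope *)

Section bends.
Variable R : realType.
Implicit Types (c v a b l x y k : R) (f g : R -> R).

(* A hyperbola rising from the value v at c, with slope l there, towards the
   asymptote v + a. *)
Definition bend_right c v a l x : R := v + a - a ^+ 2 / (a + l * (x - c)).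

Definition bend_left c v a l x : R := v - a + a ^+ 2 / (a + l * (c - x)).

(** A point reflection exchanges the two arcs, so facts about the left arc reduce to facts about the
    right one. *)
Lemma bend_leftE c v a l x :
  bend_left c v a l x = - bend_right (- c) (- v) a l (- x).
Proof. by rewrite /bend_left /bend_right !opprD !opprK (addrC (- x)). Qed.

Lemma bend_right_start c v a l : 0 < a -> bend_right c v a l c = v.
Proof.
by move=> a0; rewrite /bend_right subrr mulr0 addr0; field; rewrite gt_eqF.
Qed.

Lemma bend_left_end c v a l : 0 < a -> bend_left c v a l c = v.
Proof. by move=> a0; rewrite bend_leftE bend_right_start ?opprK. Qed.

Lemma bend_right_homo c v a l x y : 0 < a -> 0 < l -> c <= x -> x < y ->
  bend_right c v a l x < bend_right c v a l y.
Proof.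
move=> a0 l0 cx xy; rewrite ltrD2l ltrN2 ltr_pM2l ?exprn_gt0//.
by rewrite ltf_pV2 ?posrE; nra.
Qed.

Lemma bend_left_homo c v a l x y : 0 < a -> 0 < l -> x < y -> y <= c ->
  bend_left c v a l x < bend_left c v a l y.
Proof.
by move=> a0 l0 xy yc; rewrite !bend_leftE ltrN2 bend_right_homo ?lerN2 ?ltrN2.
Qed.

Lemma bend_right_lt c v a l x : 0 < a -> 0 < l -> c <= x ->
  bend_right c v a l x < v + a.
Proof.
move=> a0 l0 cx; rewrite gtrBl divr_gt0 ?exprn_gt0//.
by rewrite ltr_pwDl// mulr_ge0// ?subr_ge0// ltW.
Qed.

Lemma bend_left_gt c v a l x : 0 < a -> 0 < l -> x <= c ->
  v - a < bend_left c v a l x.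
Proof.
move=> a0 l0 xc; rewrite ltrDl divr_gt0 ?exprn_gt0//.
by rewrite ltr_pwDl// mulr_ge0// ?subr_ge0// ltW.
Qed.

Lemma bend_right_ge c v a l x : 0 < a -> 0 < l -> c <= x ->
  v <= bend_right c v a l x.
Proof.
move=> a0 l0; rewrite le_eqVlt => /predU1P[<-|cx].
  by rewrite bend_right_start.
by rewrite -[leLHS](bend_right_start c v l a0) ltW// bend_right_homo.
Qed.

Lemma bend_left_le c v a l x : 0 < a -> 0 < l -> x <= c ->
  bend_left c v a l x <= v.
Proof.
by move=> a0 l0 xc; rewrite bend_leftE lerNl bend_right_ge// lerN2.
Qed.

Lemma is_derive_bend_right c v a l x : 0 < a -> 0 < l -> c <= x ->
  is_derive x 1 (bend_right c v a l) (a ^+ 2 * l / (a + l * (x - c)) ^+ 2).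
Proof.
move=> a0 l0 cx.
have dn0 y : c <= y -> 0 < a + l * (y - c).
  by move=> cy; rewrite ltr_pwDl// mulr_ge0// ?subr_ge0// ltW.
have d0 : a + l * (x - c) != 0 by rewrite gt_eqF// dn0.
have cd : a + l * (y - c) @[y --> x] --> a + l * (x - c).
  apply: cvgD; first exact: cvg_cst.
  by apply: cvgMl_tmp; apply: cvgB; [exact: cvg_id|exact: cvg_cst].
apply/is_derive_slope; apply: cvg_within_filter.
(* For [y] near [x] and distinct from it, the difference quotient equals this fraction exactly. *)
have cq : a ^+ 2 * l / ((a + l * (x - c)) * (a + l * (y - c))) @[y --> x] -->
    a ^+ 2 * l / (a + l * (x - c)) ^+ 2.
  apply: cvgMl_tmp; apply: cvgV; first by rewrite mulf_neq0.
  exact: cvgMl_tmp.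
have {}cq := cvg_trans (cvg_app _ (@nbhs_dnbhs _ x)) cq.
apply: cvg_trans cq; apply: near_eq_cvg.
near=> y.
have yx : y - x != 0 by rewrite subr_eq0; near: y; exact: nbhs_dnbhs_neq.
have dy : a + l * (y - c) != 0.
  near: y; apply: nbhs_dnbhs; exact: (cvgr_neq0 _ cd).
by rewrite /bend_right; field; rewrite yx d0 dy.
Unshelve. all: by end_near. Qed.

Lemma is_derive_bend_left c v a l x : 0 < a -> 0 < l -> x <= c ->
  is_derive x 1 (bend_left c v a l) (a ^+ 2 * l / (a + l * (c - x)) ^+ 2).
Proof.
move=> a0 l0 xc.
have dr : is_derive (- x) 1 (bend_right (- c) (- v) a l)
    (a ^+ 2 * l / (a + l * (c - x)) ^+ 2).
  rewrite (_ : c - x = - x - - c); last by rewrite opprK addrC.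
  by apply: is_derive_bend_right; rewrite ?lerN2.
have := is_deriveN (is_derive1_comp dr (is_deriveNid x 1)).
rewrite mulrN1 opprK; congr is_derive.
by apply/funext => y; rewrite bend_leftE.
Qed.

Lemma bend_slope_gt0 a l x : 0 < a -> 0 < l -> 0 <= x ->
  0 < a ^+ 2 * l / (a + l * x) ^+ 2.
Proof.
move=> a0 l0 x0.
by rewrite !(divr_gt0, mulr_gt0, exprn_gt0)// ltr_pwDl// mulr_ge0// ltW.
Qed.

(** The starting slope is [l] whatever the height [a], so arcs of different heights join with a
    common derivative. *)
Lemma bend_slope0 a l : 0 < a -> a ^+ 2 * l / (a + l * 0) ^+ 2 = l.
Proof. by move=> a0; rewrite mulr0 addr0; field; rewrite gt_eqF. Qed.

(** * Functions with positive derivative everywhere, and sigmoids among them *)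

Definition rising f := forall x, exists2 l : R, 0 < l & is_derive x 1 f l.

Lemma is_derive_continuous f x l : is_derive x 1 f l -> {for x, continuous f}.
Proof.
by move=> [df _]; apply: differentiable_continuous; exact/derivable1_diffP.
Qed.

Lemma rising_continuous f : rising f -> continuous f.
Proof. by move=> rf x; have [l _ /is_derive_continuous] := rf x. Qed.

Lemma rising_homo f : rising f -> {homo f : x y / x < y}.
Proof.
move=> rf x y xy; apply: (@gtr0_derive1_incr R f x y) => // [z _|z _|].
- by have [l _ []] := rf z.
- by have [l l0 df] := rf z; rewrite derive1E (@derive_val _ _ _ _ _ _ _ df).
- by apply: continuous_subspaceT; exact: rising_continuous.
Qed.

Lemma rising_convex f g k : 0 <= k <= 1 -> rising f -> rising g ->
  rising (fun x => k * f x + (1 - k) * g x).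
Proof.
move=> k01 rf rg x; have [l l0 df] := rf x; have [m m0 dg] := rg x.
exists (k * l + (1 - k) * m); first by nra.
by have := is_deriveD (is_deriveZ k df) (is_deriveZ (1 - k) dg).
Qed.

Lemma rising_slope_within D f x : rising f ->
  exists2 l : R, 0 < l & slope_within D f x l.
Proof.
move=> rf; have [l l0 /is_derive_slope df] := rf x.
by exists l => //; exact: slope_withinS df.
Qed.

(** A sigmoid through height 1/2 at [c]; [a] and [b] bound its fall and its rise, and the shared
    slope [l] makes it differentiable at [c]. *)
Definition crossing c a b l : R -> R :=
  glue c (bend_left c (1 / 2) a l) (bend_right c (1 / 2) b l).

Section crossing.
Variables c a b l : R.
Hypotheses (a0 : 0 < a) (b0 : 0 < b) (l0 : 0 < l).

Let meet : bend_left c (1 / 2) a l c = bend_right c (1 / 2) b l c.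
Proof. by rewrite bend_left_end// bend_right_start. Qed.

Lemma crossing_mid : crossing c a b l c = 1 / 2.
Proof. by rewrite /crossing glueL// bend_left_end. Qed.

Lemma crossing_rising : rising (crossing c a b l).
Proof.
move=> x; set s := if x <= c then a ^+ 2 * l / (a + l * (c - x)) ^+ 2
  else b ^+ 2 * l / (b + l * (x - c)) ^+ 2.
exists s.
  by rewrite /s; case: (leP x c) => xc; apply: bend_slope_gt0 => //; lra.
apply/is_derive_slope; apply: slope_glue meet _ _ => [xc|cx].
  apply: (@slope_withinS _ setT) => //; apply/is_derive_slope.
  by rewrite /s xc; exact: is_derive_bend_left.
apply: (@slope_withinS _ setT) => //; apply/is_derive_slope.
rewrite (_ : s = b ^+ 2 * l / (b + l * (x - c)) ^+ 2); last first.
  (* Only [x = c] remains, where both formulas for the slope reduce to [l]. *)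
  rewrite /s; case: (leP x c) => // xc; have -> : x = c by lra.
  by rewrite subrr !bend_slope0.
exact: is_derive_bend_right.
Qed.

Lemma crossing_bounds x : 1 / 2 - a < crossing c a b l x < 1 / 2 + b.
Proof.
have [xc|/ltW cx] := leP x c.
  rewrite /crossing glueL//.
  rewrite bend_left_gt//= (le_lt_trans (bend_left_le (1 / 2) a0 l0 xc))//.
  by rewrite ltrDl.
rewrite /crossing glueR//.
rewrite bend_right_lt// (lt_le_trans _ (bend_right_ge (1 / 2) b0 l0 cx))//.
by rewrite gtrBl.
Qed.

End crossing.

(* The slope d ^- 2 makes the arc fall below d within distance d of c. *)
Lemma crossing_low c d x : 0 < d -> x <= c - d ->
  crossing c (1 / 2) d (d ^- 2) x <= d.
Proof.
move=> d0 xcd; rewrite /crossing glueL; last lra.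
rewrite /bend_left subrr add0r.
have xd : d ^-1 <= d ^- 2 * (c - x).
  rewrite (_ : d^-1 = d ^- 2 * d); last by field; rewrite gt_eqF.
  by rewrite ler_pM2l ?invr_gt0 ?exprn_gt0//; lra.
have d1 : 0 < d^-1 by rewrite invr_gt0.
rewrite ler_pdivrMr; last lra.
have : 1 <= d * (d ^- 2 * (c - x)).
  by rewrite (le_trans _ (ler_wpM2l (ltW d0) xd))// divff ?gt_eqF.
by nra.
Qed.

(** Counterpart of [crossing_low]: from distance [d] on, [d ^- 2 * (x - c)] is at least [d^-1],
    which brings the gap to the asymptote 1 below [d]. *)
Lemma crossing_high c d x : 0 < d -> c + d <= x ->
  1 - d <= crossing c d (1 / 2) (d ^- 2) x.
Proof.
move=> d0 xcd; rewrite /crossing glueR; last 2 first.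
- by rewrite bend_left_end// bend_right_start//; lra.
- lra.
have xd : d ^-1 <= d ^- 2 * (x - c).
  rewrite (_ : d^-1 = d ^- 2 * d); last by field; rewrite gt_eqF.
  by rewrite ler_pM2l ?invr_gt0 ?exprn_gt0//; lra.
have d1 : 0 < d^-1 by rewrite invr_gt0.
rewrite /bend_right (_ : 1 / 2 + 1 / 2 = 1); last by field.
rewrite lerD2l lerN2 ler_pdivrMr; last lra.
have : 1 <= d * (d ^- 2 * (x - c)).
  by rewrite (le_trans _ (ler_wpM2l (ltW d0) xd))// divff ?gt_eqF.
by nra.
Qed.

End bends.

(** * Extension of an interior increasing strategy to the whole line *)

Section extension.
Variable R : realType.
Variables (sigma : R -> R) (l0 l1 : R).
Hypotheses (l0_gt0 : 0 < l0) (l1_gt0 : 0 < l1) (si : interior_strategy sigma)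
  (s_homo : {in `[0, 1] &, {homo sigma : x y / x < y}}).

(** The heights [sigma 0] and [1 - sigma 1] put the asymptotes at 0 and 1, so that the extension
    never leaves ]0, 1[. *)
Definition extension : R -> R :=
  glue 0 (bend_left 0 (sigma 0) (sigma 0) l0)
    (glue 1 sigma (bend_right 1 (sigma 1) (1 - sigma 1) l1)).

Let zero01 : (0 : R) \in `[0, 1]. Proof. by rewrite in_itv /=; lra. Qed.
Let one01 : (1 : R) \in `[0, 1]. Proof. by rewrite in_itv /=; lra. Qed.
Let s0_gt0 : 0 < sigma 0. Proof. by have /andP[] := si zero01. Qed.
Let s1_lt1 : 0 < 1 - sigma 1.
Proof. by rewrite subr_gt0; have /andP[] := si one01. Qed.

Let meet1 : sigma 1 = bend_right 1 (sigma 1) (1 - sigma 1) l1 1.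
Proof. by rewrite bend_right_start. Qed.

Let meet0 : bend_left 0 (sigma 0) (sigma 0) l0 0 =
  glue 1 sigma (bend_right 1 (sigma 1) (1 - sigma 1) l1) 0.
Proof. by rewrite bend_left_end// glueL. Qed.

Lemma extensionE : {in `[0, 1], extension =1 sigma}.
Proof.
move=> x; rewrite in_itv /= => /andP[x0 x1].
by rewrite /extension glueR// glueL.
Qed.

Lemma extension_in01 x : 0 < extension x < 1.
Proof.
have [x0|/ltW x0] := leP x 0.
  rewrite /extension glueL//.
  have := bend_left_gt (sigma 0) s0_gt0 l0_gt0 x0; rewrite subrr => -> /=.
  rewrite (le_lt_trans (bend_left_le _ s0_gt0 l0_gt0 x0))//.
  by have /andP[] := si zero01.
have [x1|/ltW x1] := leP x 1; first by rewrite extensionE ?si// in_itv /= x0.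
rewrite /extension glueR// glueR//.
have := bend_right_lt (sigma 1) s1_lt1 l1_gt0 x1.
rewrite [X in _ < X]addrC subrK => ->; rewrite andbT.
rewrite (lt_le_trans _ (bend_right_ge _ s1_lt1 l1_gt0 x1))//.
by have /andP[] := si one01.
Qed.

Lemma extension_homo : {homo extension : x y / x < y}.
Proof.
(* The inner gluing is compared only on nonnegative reals, since nothing is assumed about [sigma] to
   the left of 0. *)
have right_homo x y : 0 <= x -> 0 <= y -> x < y ->
    glue 1 sigma (bend_right 1 (sigma 1) (1 - sigma 1) l1) x <
    glue 1 sigma (bend_right 1 (sigma 1) (1 - sigma 1) l1) y.
  apply: (@homo_glue R [set z | 0 <= z] 1) => //= {x y}.
  - by move=> x y x0 y0 xy y1; apply: s_homo => //; rewrite in_itv /=; lra.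
  - by move=> x y x0 y0 xy x1; exact: bend_right_homo.
move=> x y; apply: (@homo_glue R setT 0) => // {}x {}y _ _ xy.
  by move=> y0; exact: bend_left_homo.
by move=> x0; apply: right_homo => //; exact: le_trans (ltW xy).
Qed.

Lemma extension_continuous :
  {within `[0, 1], continuous sigma} -> continuous extension.
Proof.
move=> cs; apply/continuous_subspace_setT; rewrite /extension.
apply: continuous_glue meet0 _ _; first exact: closedT.
  apply: continuous_in_subspaceT => x; rewrite inE => -[_ /= x0].
  exact: is_derive_continuous (is_derive_bend_left _ s0_gt0 l0_gt0 x0).
rewrite setTI; apply: continuous_glue meet1 _ _; first exact: closed_ge.
  rewrite (_ : _ `&` _ = `[0, 1]%classic)//.
  by apply/seteqP; split=> x /=; rewrite in_itv /=; [case=> -> ->|case/andP].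
apply: continuous_in_subspaceT => x; rewrite inE => -[_ /= x1].
exact: is_derive_continuous (is_derive_bend_right _ s1_lt1 l1_gt0 x1).
Qed.

Lemma extension_rising :
  slope_within `[0, 1] sigma 0 l0 -> slope_within `[0, 1] sigma 1 l1 ->
  {in `]0, 1[, forall x,
    exists2 l : R, 0 < l & slope_within `[0, 1] sigma x l} ->
  rising extension.
Proof.
move=> sl0 sl1 sl x.
(* A single [l] must serve every piece that touches [x]. Away from 0 and 1 only one premise is live;
   at 0 and at 1 the prescribed slope [l0] or [l1] satisfies two. *)
have glued l : (x <= 0 ->
      is_derive x 1 (bend_left 0 (sigma 0) (sigma 0) l0) l) ->
    (0 <= x <= 1 -> slope_within `[0, 1] sigma x l) ->
    (1 <= x ->
      is_derive x 1 (bend_right 1 (sigma 1) (1 - sigma 1) l1) l) ->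
    is_derive x 1 extension l.
  move=> Hl Hm Hr; apply/is_derive_slope; apply: slope_glue meet0 _ _ => x0.
    by apply: (@slope_withinS _ setT) => //; apply/is_derive_slope; exact: Hl.
  apply: slope_glue meet1 _ _ => x1.
    apply: slope_withinS (Hm _) => [y /= [[_ ? ?]]|]; rewrite ?in_itv/=;
      exact/andP.
  by apply: (@slope_withinS _ setT) => //; apply/is_derive_slope; exact: Hr.
have [xlt0|x_gt0|x0] := ltgtP x 0.
- exists ((sigma 0) ^+ 2 * l0 / (sigma 0 + l0 * (0 - x)) ^+ 2).
    by apply: bend_slope_gt0 => //; lra.
  refine (glued _ _ _ _) => [x0|/andP[x0 _]|x1].
  + exact: (is_derive_bend_left _ s0_gt0 l0_gt0 x0).
  + by have := le_lt_trans x0 xlt0; rewrite ltxx.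
  + by have := le_lt_trans x1 xlt0; rewrite ltr10.
- have [x_lt1|x_gt1|x1] := ltgtP x 1.
  + have [|l l_gt0 Hl] := sl x; first by rewrite in_itv /= x_gt0.
    exists l; first exact: l_gt0.
    refine (glued _ _ (fun=> Hl) _) => [x0|x1].
    * by have := lt_le_trans x_gt0 x0; rewrite ltxx.
    * by have := le_lt_trans x1 x_lt1; rewrite ltxx.
  + exists ((1 - sigma 1) ^+ 2 * l1 / (1 - sigma 1 + l1 * (x - 1)) ^+ 2).
      by apply: bend_slope_gt0; rewrite // subr_ge0 ltW.
    refine (glued _ _ _ _) => [x0|/andP[_ x1]|x1].
    * by have := lt_le_trans x_gt0 x0; rewrite ltxx.
    * by have := lt_le_trans x_gt1 x1; rewrite ltxx.
    * exact: (is_derive_bend_right _ s1_lt1 l1_gt0 x1).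
  + exists l1; first exact: l1_gt0.
    refine (glued _ _ _ _) => [x0|_|x1'].
    * by have := lt_le_trans x_gt0 x0; rewrite ltxx.
    * by rewrite x1.
    * have := is_derive_bend_right (sigma 1) s1_lt1 l1_gt0 x1'.
      by rewrite x1 subrr bend_slope0.
- exists l0; first exact: l0_gt0.
  refine (glued _ _ _ _) => [x0'|_|x1].
  + have := is_derive_bend_left (sigma 0) s0_gt0 l0_gt0 x0'.
    by rewrite x0 subrr bend_slope0.
  + by rewrite x0.
  + by move: x1; rewrite x0 ler10.
Qed.

End extension.

(** * The interval of indifferent types *)

Section equilibria.
Variables (R : realType) (B : R).
Hypothesis hB : 1 < B < 2.
Implicit Types (sigma : R -> R) (Q : R * R -> R) (t x : R).
Local Notation mean sigma :=
  (\int[@completed_lebesgue_measure R]_(x in `[0, 1]) sigma x).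
Local Notation itvB := `]B / (B + 2), 2 * B / (B + 2)[.

(** These are the bounds (1 - t) / 2 < m < 1 - t / 2 on the mean m = t / B. *)
Lemma in_itvB t : t \in itvB =
  (1 - t < 2 * (t / B)) && (2 * (t / B) < 2 - t).
Proof.
have /andP[B1 Blt2] := hB; have B0 : 0 < B by lra.
have -> : t \in itvB = (B < t * (B + 2)) && (t * (B + 2) < 2 * B).
  have B2 : 0 < B + 2 by lra.
  by rewrite in_itv /= (ltr_pdivrMr _ _ B2) (ltr_pdivlMr _ _ B2).
rewrite mulrA ltr_pdivlMr// ltr_pdivrMr//.
by congr andb; apply/idP/idP => ?; nra.
Qed.

(** The right end 2 B / (B + 2) lies below 1 because B < 2. *)
Lemma itvB_sub01 t : t \in itvB -> 0 < t < 1.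
Proof.
have /andP[B1 Blt2] := hB; rewrite in_itvB; set m := t / B => tm.
have tE : t = m * B by rewrite /m divfK//; lra.
by move: tm; rewrite tE => /andP[? ?]; apply/andP; split; nra.
Qed.

(** * Necessity: the shape of equilibria *)

Lemma mean_in_itvB sigma t : is_strategy sigma -> interior_strategy sigma ->
  {in `[0, 1] &, {homo sigma : x y / x < y}} -> t = B * mean sigma ->
  {in `[0, 1], forall x, x <= t -> sigma x <= 1 / 2} ->
  {in `[0, 1], forall x, t <= x -> 1 / 2 <= sigma x} ->
  t \in itvB.
Proof.
have /andP[B1 Blt2] := hB.
move=> ss si sh tE slo shi; set m := mean sigma in tE.
have zero01 : (0 : R) \in `[0, 1] by rewrite in_itv /=; lra.
have one01 : (1 : R) \in `[0, 1] by rewrite in_itv /=; lra.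
have /andP[s0 _] := si _ zero01; have /andP[_ s1] := si _ one01.
have ge0 : {in `[0, 1], forall x, sigma 0 <= sigma x}.
  move=> x x01; have := x01; rewrite in_itv /= => /andP[+ _].
  by rewrite le_eqVlt => /predU1P[<-//|x0]; rewrite ltW// sh.
have le1 : {in `[0, 1], forall x, sigma x <= sigma 1}.
  move=> x x01; have := x01; rewrite in_itv /= => /andP[_].
  by rewrite le_eqVlt => /predU1P[->//|x1]; rewrite ltW// sh.
have t_gt0 : 0 < t.
  have := @mean_ge_step _ sigma 0 (sigma 0) (sigma 0) ss.
  rewrite -/m mulr0 add0r subr0 mulr1 lexx ler01 => sm.
  rewrite tE mulr_gt0//; first lra.
  by apply: (lt_le_trans s0); apply: sm => // x; rewrite in_itv /=; lra.
have t_lt1 : t < 1.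
  (* Otherwise [sigma] is at most 1/2 on all of [0, 1], so m <= 1/2 and t = B m <= B / 2 < 1. *)
  rewrite ltNge; apply/negP => t1.
  have := @mean_le_step _ sigma 0 (1 / 2) (1 / 2) ss.
  rewrite -/m mulr0 add0r subr0 mulr1 lexx ler01 => sm.
  suff : m <= 1 / 2 by nra.
  apply: sm => // x; first by rewrite in_itv /=; lra.
  by move=> x01; apply: slo => //; move: x01; rewrite in_itv /=; lra.
have t01 : 0 <= t <= 1 by rewrite !ltW.
(* Since 0 < t < 1, the strict inequalities sigma 1 < 1 and 0 < sigma 0 make the resulting bounds on
   m strict. *)
have hi : m <= 1 / 2 * t + sigma 1 * (1 - t).
  apply: mean_le_step => // x; rewrite in_itv /= => xt.
    by apply: slo; rewrite ?in_itv /=; lra.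
  by apply: le1; rewrite in_itv /=; lra.
have lo : sigma 0 * t + 1 / 2 * (1 - t) <= m.
  apply: mean_ge_step => // x; rewrite in_itv /= => xt.
    by apply: ge0; rewrite in_itv /=; lra.
  by apply: shi; rewrite ?in_itv /=; lra.
have mE : t / B = m by rewrite tE mulrC mulKf//; lra.
by rewrite in_itvB mE; apply/andP; split; nra.
Qed.

(** [payoff_monotone] excludes a value above 1/2 on the diagonal. A value below 1/2 would persist by
    continuity at points with v^1 slightly above v^0, where [Q] exceeds 1/2. *)
Lemma payoff_monotone_half Q a : continuous Q -> payoff_monotone Q ->
  Q (a, a) = 1 / 2.
Proof.
move=> cQ mQ; apply/eqP; rewrite eq_le; apply/andP; split.
  rewrite leNgt; apply/negP => Qa.
  by suff /(mQ (a, a)) : 1 - Q (a, a) < Q (a, a); rewrite ?ltxx//; lra.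
rewrite leNgt; apply/negP => Qa.
have cx : Q (x, a) @[x --> a^'+] --> Q (a, a).
  apply: cvg_at_right_filter.
  have cc : {for a, continuous (fun=> a : R)} by exact: cvg_cst.
  exact: (cvg_comp _ Q (cvg_pair (@cvg_id _ (nbhs a)) cc) (cQ (a, a))).
have : \forall x \near a^'+, False.
  near=> x.
  have xa : a < x by near: x; exact: nbhs_right_gt.
  have : Q (x, a) < 1 / 2 by near: x; exact: (cvgr_lt _ cx).
  by have /(mQ (x, a)) : (x, a).2 < (x, a).1 := xa; lra.
by move=> /filter_ex[].
Unshelve. all: by end_near. Qed.

(** The abstention payoff [a] is the same for all types, so [sigma] is the trace of [Q] on the line
    x -> (a, B - x), which meets the diagonal at x = t. *)
Lemma monotone_QRE_shape sigma : is_monotone_QRE B sigma ->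
  [/\ continuous_increasing sigma, interior_strategy sigma &
      unique_indifferent_type B sigma].
Proof.
move=> [ss [Q [sQ iQ cQ [_ hQ] mQ]]].
set a := payoff_abstain B sigma in sQ.
have sQ' x : x \in `[0, 1] -> sigma x = Q (a, B - x) by exact: sQ.
have si : interior_strategy sigma by move=> x /sQ' ->; exact: iQ.
have sh : {in `[0, 1] &, {homo sigma : x y / x < y}}.
  by move=> x y /sQ' -> /sQ' -> xy; apply: hQ; rewrite ltrD2l ltrN2.
set t := B * mean sigma.
have aE : a = B - t by rewrite /a /payoff_abstain meanC// mulrBr mulr1.
have half : Q (a, B - t) = 1 / 2 by rewrite aE; exact: payoff_monotone_half.
have tB : t \in itvB.
  apply: mean_in_itvB ss si sh erefl _ _ => x x01.
    move=> xt; rewrite sQ' // -half; move: xt.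
    by rewrite le_eqVlt => /predU1P[->//|xt]; rewrite ltW// hQ// ltrD2l ltrN2.
  move=> tx; rewrite sQ' // -half; move: tx.
  by rewrite le_eqVlt => /predU1P[<-//|tx]; rewrite ltW// hQ// ltrD2l ltrN2.
split=> //; first split=> //.
- apply: (@subspace_eq_continuous _ _ _ (fun x => Q (a, B - x))).
    by move=> x; rewrite inE => x01; exact/esym/sQ'.
  apply: continuous_subspaceT => x.
  have cc : {for x, continuous (fun=> a : R)} by exact: cvg_cst.
  have cB : {for x, continuous (fun y : R => B - y)}.
    by apply: cvgB; [exact: cvg_cst|exact: cvg_id].
  exact: (cvg_comp _ Q (cvg_pair cc cB) (cQ (a, B - x))).
(* Uniqueness is immediate: the mean of [sigma] determines [t]. *)
- exists t; split; last by move=> t' [].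
  split=> //; rewrite sQ'// in_itv /=.
  by have /andP[/ltW -> /ltW ->] := itvB_sub01 tB.
Qed.

Lemma differentially_strictly_responsive Q :
  differentially_responsive Q -> strictly_responsive Q.
Proof.
move=> rQ; split=> [b|a].
  apply: rising_homo => x; have [d _ d_gt0 _] := rQ (x, b).
  exists (derive1 (fun y => Q (y, b)) x); first exact: d_gt0.
  by apply: DeriveDef; [exact: d|rewrite derive1E].
(* Negation turns decrease in the second coordinate into a rising function. *)
move=> x y yx; rewrite -ltrN2.
apply: (@rising_homo R (fun z => - Q (a, z))) yx => z.
have [_ d _ d_lt0] := rQ (a, z).
exists (- derive1 (fun z => Q (a, z)) z); first by rewrite oppr_gt0.
by apply: is_deriveN; apply: DeriveDef; [exact: d|rewrite derive1E].
Qed.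

Lemma QRE_monotone_QRE sigma : is_QRE B sigma -> is_monotone_QRE B sigma.
Proof.
move=> [ss [Q [sQ iQ cQ rQ mQ]]]; split=> //; exists Q; split=> //.
exact: differentially_strictly_responsive.
Qed.

(** On [0, 1] the strategy agrees with y -> Q (a, B - y), which is differentiable on the whole line;
    restricting that derivative yields the one-sided slopes at the ends. *)
Lemma QRE_positive_slope sigma : is_QRE B sigma -> positive_slope sigma.
Proof.
move=> [ss [Q [sQ _ _ rQ _]]] x x01; set a := payoff_abstain B sigma in sQ.
have [_ d _ d_lt0] := rQ (a, B - x).
exists (- derive1 (fun b => Q (a, b)) (B - x)); first by rewrite oppr_gt0.
rewrite -/(slope_within `[0, 1] sigma x _).
apply: (@eq_slope_within _ _ (fun y => Q (a, B - y))); first by rewrite -sQ.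
  by move=> y; rewrite inE => /sQ ->.
apply: (@slope_withinS _ setT) => //; apply/is_derive_slope.
have dQ : is_derive (B - x) 1 (fun b => Q (a, b))
    (derive1 (fun b => Q (a, b)) (B - x)).
  by apply: DeriveDef; [exact: d|rewrite derive1E].
have dB : is_derive x 1 (fun y => B - y) (-1).
  have := is_deriveB (is_derive_cst B x 1) (is_derive_id x 1).
  by rewrite sub0r.
rewrite -mulrN1.
exact: (@is_derive1_comp _ (fun b => Q (a, b)) (fun y => B - y)).
Qed.

(** * Sufficiency: a quantal response function from an extended strategy *)

Lemma QRE_of_extension (responsive : (R * R -> R) -> Prop) sigma E t :
  is_strategy sigma -> t = B * mean sigma ->
  {in `[0, 1], E =1 sigma} -> E t = 1 / 2 ->
  (forall x, 0 < E x < 1) -> continuous E -> {homo E : x y / x < y} ->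
  responsive (fun v => E (v.1 - v.2 + t)) ->
  is_QRE_with responsive B sigma.
Proof.
move=> ss tE Es Et E01 cE hE rE; split=> //.
(* [Q] sees only the payoff difference. Type x gains x - t, so [E] is evaluated at x itself;
   [E t = 1 / 2] and monotonicity give [payoff_monotone]. *)
exists (fun v => E (v.1 - v.2 + t)); split=> //.
- move=> x x01; rewrite -Es//; congr E.
  by rewrite /= /payoff_abstain /payoff_volunteer meanC// tE; ring.
- move=> v; apply: (@continuous_comp _ _ _ (fun v : R * R => v.1 - v.2 + t) E).
    apply: cvgD; last exact: cvg_cst.
    by apply: cvgB; [exact: cvg_fst|exact: cvg_snd].
  exact: cE.
- move=> v; split=> [v21|].
    have : E t < E (v.1 - v.2 + t) by apply: hE; lra.
    by rewrite Et; lra.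
  move=> Ev; rewrite ltNge; apply/negP => v12.
  have : E (v.1 - v.2 + t) <= E t.
    have : v.1 - v.2 + t <= t by lra.
    by rewrite le_eqVlt => /predU1P[->//|/hE/ltW].
  by rewrite Et; lra.
Qed.

Lemma strictly_responsive_diff E t : {homo E : x y / x < y} ->
  strictly_responsive (fun v : R * R => E (v.1 - v.2 + t) : R).
Proof. by move=> hE; split=> [b|a] x y xy /=; apply: hE; lra. Qed.

Lemma differentially_responsive_diff E t : rising E ->
  differentially_responsive (fun v : R * R => E (v.1 - v.2 + t) : R).
Proof.
move=> rE v; have [l l_gt0 dE] := rE (v.1 - v.2 + t).
have d1 : is_derive v.1 1 (fun a => E (a - v.2 + t)) l.
  have d : is_derive v.1 1 (fun a => a - v.2 + t) 1.
    have := is_deriveD (is_deriveB (is_derive_id v.1 1)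
      (is_derive_cst v.2 v.1 1)) (is_derive_cst t v.1 1).
    by rewrite subr0 addr0.
  rewrite -(mulr1 l).
  exact: (@is_derive1_comp _ E (fun a => a - v.2 + t)).
have d2 : is_derive v.2 1 (fun b => E (v.1 - b + t)) (- l).
  have d : is_derive v.2 1 (fun b => v.1 - b + t) (-1).
    have := is_deriveD (is_deriveB (is_derive_cst v.1 v.2 1)
      (is_derive_id v.2 1)) (is_derive_cst t v.2 1).
    by rewrite sub0r addr0.
  rewrite -mulrN1.
  exact: (@is_derive1_comp _ E (fun b => v.1 - b + t)).
case: d1 => d1 e1; case: d2 => d2 e2; split.
- exact: d1.
- exact: d2.
- by rewrite /= derive1E e1.
- by rewrite /= derive1E e2 oppr_lt0.
Qed.

(** The common part of both converses, with the end slopes left free. Responsiveness is asked for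
    every [t] because the indifferent type is extracted only inside the proof. *)
Lemma shape_QRE (responsive : (R * R -> R) -> Prop) l0 l1 sigma :
  is_strategy sigma -> 0 < l0 -> 0 < l1 ->
  [/\ continuous_increasing sigma, interior_strategy sigma &
      unique_indifferent_type B sigma] ->
  (forall t, responsive (fun v => extension sigma l0 l1 (v.1 - v.2 + t))) ->
  is_QRE_with responsive B sigma.
Proof.
move=> ss l0_gt0 l1_gt0 [[cs hs] si [t [[tB st tE] _]]] rE.
have Es := @extensionE _ _ l0 l1 si.
apply: (QRE_of_extension ss tE Es) (rE t).
- by rewrite Es// in_itv /=; have /andP[/ltW -> /ltW ->] := itvB_sub01 tB.
- exact: extension_in01.
- exact: extension_continuous.
- exact: extension_homo.
Qed.

Lemma QRE_iff sigma : is_strategy sigma ->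
  is_QRE B sigma <->
  [/\ continuous_increasing sigma /\ positive_slope sigma,
      interior_strategy sigma & unique_indifferent_type B sigma].
Proof.
move=> ss; split=> [qs|[[cs ps] si us]].
  have [? ? ?] := monotone_QRE_shape (QRE_monotone_QRE qs).
  by split=> //; split=> //; exact: QRE_positive_slope.
have [|l0 l0_gt0 sl0] := ps 0; first by rewrite in_itv /=; lra.
have [|l1 l1_gt0 sl1] := ps 1; first by rewrite in_itv /=; lra.
apply: (shape_QRE ss l0_gt0 l1_gt0) => // t.
apply: differentially_responsive_diff.
apply: extension_rising => // x x01; apply: ps.
by apply: subset_itv_oo_cc x01.
Qed.

Lemma monotone_QRE_iff sigma : is_strategy sigma ->
  is_monotone_QRE B sigma <->
  [/\ continuous_increasing sigma, interior_strategy sigma &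
      unique_indifferent_type B sigma].
Proof.
move=> ss; split; first exact: monotone_QRE_shape.
(* No derivative has to be matched at 0 and 1, so both arcs start with slope 1. *)
move=> sh; apply: (shape_QRE ss (@ltr01 R) (@ltr01 R) sh) => t.
apply: strictly_responsive_diff; case: sh => -[_ hs] si _.
exact: extension_homo.
Qed.

(** * Existence of an equilibrium for each indifferent type *)

Lemma exists_rising_mean t (m : R) : 0 < t < 1 ->
  1 - t < 2 * m -> 2 * m < 2 - t ->
  exists sigma, [/\ is_strategy sigma, rising sigma, forall x, 0 < sigma x < 1,
    sigma t = 1 / 2 & mean sigma = m].
Proof.
move=> /andP[t0 t1] tm mt.
(* The mean bounds below miss their limits by 3 d / 2, so margins of 2 d suffice. Adding 2 d <= t
   and 2 d <= 1 - t gives d <= 1/4, which keeps all values in ]0, 1[. *)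
have [d [d_gt0 dt d1t dlo dhi]] : exists d : R, [/\ 0 < d, 2 * d <= t,
    2 * d <= 1 - t, 2 * d <= m - (1 - t) / 2 & 2 * d <= 1 - t / 2 - m].
  pose e := Num.min (Num.min t (1 - t))
    (Num.min (m - (1 - t) / 2) (1 - t / 2 - m)).
  exists (e / 2); rewrite (_ : 2 * (e / 2) = e); last by field.
  rewrite /e !ge_min !lexx !orbT; split=> //.
  by rewrite divr_gt0// !lt_min; lra.
have half_gt0 : (0 : R) < 1 / 2 by lra.
have l_gt0 : 0 < d ^- 2 by rewrite invr_gt0 exprn_gt0.
(* [lo] drops quickly towards 0 before [t] and stays below 1/2 + d after it; [hi] stays above 1/2 -
   d before [t] and climbs quickly towards 1 after it. *)
pose lo := crossing t (1 / 2) d (d ^- 2).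
pose hi := crossing t d (1 / 2) (d ^- 2).
have lo01 x : 0 < lo x < 1 / 2 + d.
  by have := crossing_bounds t half_gt0 d_gt0 l_gt0 x; rewrite subrr.
have hi01 x : 1 / 2 - d < hi x < 1.
  have := crossing_bounds t d_gt0 half_gt0 l_gt0 x.
  by rewrite (_ : 1 / 2 + 1 / 2 = 1)//; field.
have rlo : rising lo by exact: crossing_rising.
have rhi : rising hi by exact: crossing_rising.
have slo : is_strategy lo.
  apply: strategy_of_continuous; first exact: rising_continuous.
  by move=> x _; have := lo01 x; lra.
have shi : is_strategy hi.
  apply: strategy_of_continuous; first exact: rising_continuous.
  by move=> x _; have := hi01 x; lra.
have mlo : mean lo < m.
  (* The step is placed at [t - d], since the arc needs distance [d] to fall below [d]; the
     quadratic terms in [d] cancel in the bound. *)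
  have := @mean_le_step _ lo (t - d) d (1 / 2 + d) slo.
  suff : d * (t - d) + (1 / 2 + d) * (1 - (t - d)) < m.
    move=> H /(_ _ _ _)/le_lt_trans; apply=> //; first lra.
    - by move=> x; rewrite in_itv /= => xt; apply: crossing_low => //; lra.
    - by move=> x _; have := lo01 x; lra.
  by rewrite [ltLHS](_ : _ = (1 - t) / 2 + 3 / 2 * d); [lra|field].
have mhi : m < mean hi.
  have := @mean_ge_step _ hi (t + d) (1 / 2 - d) (1 - d) shi.
  suff : m < (1 / 2 - d) * (t + d) + (1 - d) * (1 - (t + d)).
    move=> H /(_ _ _ _)/(lt_le_trans H); apply=> //; first lra.
    - by move=> x _; have := hi01 x; lra.
    - by move=> x; rewrite in_itv /= => xt; apply: crossing_high => //; lra.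
  by rewrite [ltRHS](_ : _ = 1 - t / 2 - 3 / 2 * d); [lra|field].
(* The weight that solves k * mean lo + (1 - k) * mean hi = m. *)
pose k := (mean hi - m) / (mean hi - mean lo).
have k01 : 0 <= k <= 1.
  have lohi := lt_trans mlo mhi.
  rewrite divr_ge0 ?subr_ge0 ?(ltW lohi) ?(ltW mhi)//=.
  by rewrite ler_pdivrMr ?subr_gt0// mul1r lerD2l lerN2 ltW.
have mid01 x : 0 < k * lo x + (1 - k) * hi x < 1.
  have := lo01 x; have := hi01 x; move: (lo x) (hi x) => u v uv vu.
  have [? [? [? ?]]] : 0 < u /\ 0 < v /\ u < 1 /\ v < 1 by lra.
  by apply/andP; split; nra.
exists (fun x => k * lo x + (1 - k) * hi x); split=> //.
- apply: strategy_of_continuous; last by move=> x _; have := mid01 x; lra.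
  by apply: rising_continuous; exact: rising_convex.
- exact: rising_convex.
- by rewrite /lo /hi !crossing_mid//; field.
- rewrite mean_convex// /k; field.
  by rewrite subr_eq0 gt_eqF// (lt_trans mlo).
Qed.

(** Indifference of [t] forces the mean t / B, and [in_itvB] places this number strictly inside the
    range covered by [exists_rising_mean]. *)
Lemma exists_QRE t : t \in itvB ->
  exists2 sigma, is_QRE B sigma & indifferent_type B sigma t.
Proof.
move=> tB; have t01 := itvB_sub01 tB.
have tm := tB; rewrite in_itvB in tm; have /andP[tlo thi] := tm.
have [sigma [ss rs s01 st sm]] := exists_rising_mean t01 tlo thi.
have tE : t = B * mean sigma.
  by rewrite sm mulrC divfK//; case/andP: hB; lra.
exists sigma; last first.
  split; last by rewrite payoff_gainE// -tE subrr.
  by rewrite in_itv /=; case/andP: t01 => /ltW -> /ltW ->.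
apply/QRE_iff => //; split; [split; [split|]|by move=> x _|].
- by apply: continuous_subspaceT; exact: rising_continuous.
- by move=> x y _ _; exact: rising_homo.
- by move=> x _; exact: rising_slope_within.
- by exists t; split=> // t' [_ _ ->].
Qed.

(** A sandwich: the smaller class [is_QRE] already realises every point of the interval, and the
    larger class [is_monotone_QRE] realises no other. Both versions of equilibrium are instances of
    [P]. *)
Lemma indifferent_typesE (P : (R -> R) -> Prop) :
  (forall sigma, is_QRE B sigma -> P sigma) ->
  (forall sigma, P sigma -> is_monotone_QRE B sigma) ->
  indifferent_types P B = [set` itvB].
Proof.
move=> QP PQ; apply/seteqP; split=> t /=.
  move=> [sigma /PQ qs [_]]; have [ss _] := qs.
  have [_ _ [t' [[t'B _ t'E] _]]] := monotone_QRE_shape qs.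
  by rewrite payoff_gainE// -t'E => /subr0_eq ->.
by move=> /exists_QRE[sigma /QP qs it]; exists sigma.
Qed.

End equilibria.

(** Two readings of responsiveness: with partial derivatives the characterization acquires
    [positive_slope]; with strict monotonicity it consists of (i)-(iii) alone. The set of
    indifferent types is the same. *)
Theorem proposition2 (R : realType) (B : R) (hB : 1 < B < 2) :
  (indifferent_types (is_QRE B) B = `]B / (B + 2), 2 * B / (B + 2)[%classic /\
   forall sigma : R -> R, is_strategy sigma ->
     (is_QRE B sigma <->
      [/\ continuous_increasing sigma /\ positive_slope sigma,
          interior_strategy sigma & unique_indifferent_type B sigma])) /\
  (indifferent_types (is_monotone_QRE B) B
     = `]B / (B + 2), 2 * B / (B + 2)[%classic /\
   forall sigma : R -> R, is_strategy sigma ->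
     (is_monotone_QRE B sigma <->
      [/\ continuous_increasing sigma, interior_strategy sigma &
          unique_indifferent_type B sigma])).
Proof.
split; split=> [|sigma].
- by apply: indifferent_typesE => // sigma; exact: QRE_monotone_QRE.
- exact: QRE_iff.
- by apply: indifferent_typesE => // sigma; exact: QRE_monotone_QRE.
- exact: monotone_QRE_iff.
Qed.
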